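(* Suppose that the sequences of real numbers $\sup_{u \in X} \| \mathcal G(u) - m^{\mathcal G}_N(u) \|$ and $\sup_{u \in X} | \Phi(u) - m^{\Phi}_N(u) |$, $N\in\mathbb N$, converge to $0$ as $N \to \infty$, and that $\sup_{u \in X}\|\mathcal G(u)\| \leq C_{\mathcal G}<\infty$. Then there exist constants $C_1$ and $C_2$, independent of $N$ and of the design points $U_N$, such that for all $N$ $$d_{\mathrm{Hell}}(\mu^y, \mu^{y,N,\mathcal G}_{\mathrm{mean}}) \leq C_1 \left\|\mathcal G - m^{\mathcal G}_N \right\|_{L^2_{\mu_0}(X; \mathbb R^J)} \quad\text{and}\quad d_{\mathrm{Hell}}(\mu^y, \mu^{y,N,\Phi}_{\mathrm{mean}}) \leq C_2 \left\|\Phi - m^{\Phi}_N \right\|_{L^2_{\mu_0}(X)}.$$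
   Context: Let $K,J\in\mathbb N$, let $X\subseteq\mathbb R^K$ be measurable, let $\mathcal G=(\mathcal G^1,\dots,\mathcal G^J): X\to\mathbb R^J$ be measurable (the parameter-to-observation map), let $y\in\mathbb R^J$ (data) and $\sigma_\eta^2>0$ (noise variance) be fixed, and let $\mu_0$ be a probability measure on $\mathbb R^K$ with $\mu_0(X)=1$ (the prior). $\|\cdot\|$ denotes the Euclidean norm and $\mathbb E_{\mu_0}$ the expectation with respect to $\mu_0$. Define $$\Phi(u)=\frac1{2\sigma_\eta^2}\|y-\mathcal G(u)\|^2,\qquad Z=\mathbb E_{\mu_0}\big(\exp(-\Phi(u))\big),$$ and let the posterior $\mu^y$ be given by $\frac{d\mu^y}{d\mu_0}(u)=\frac1Z\exp(-\Phi(u))$. For each $N\in\mathbb N$ let $U_N\subseteq X$ be a set of $N$ distinct design points, and let $m_N^{\mathcal G}=(m_N^{\mathcal G^1},\dots,m_N^{\mathcal G^J}):X\to\mathbb R^J$ and $m_N^\Phi:X\to\mathbb R$ be the (measurable) predictive means of Gaussian process emulators of $\mathcal G$ and $\Phi$ built from evaluations at $U_N$. No property of $m_N^{\mathcal G}$ and $m_N^\Phi$ other than those stated in the claim is assumed, i.e. they may be regarded as arbitrary measurable functions. Define the approximate posteriors by $$\frac{d\mu^{y,N,\mathcal G}_{\mathrm{mean}}}{d\mu_0}(u)=\frac1{Z^{\mathrm{mean}}_{N,\mathcal G}}\exp\Big(-\frac1{2\sigma_\eta^2}\|y-m_N^{\mathcal G}(u)\|^2\Big),\quad Z^{\mathrm{mean}}_{N,\mathcal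 G}=\mathbb E_{\mu_0}\Big(\exp\Big(-\frac1{2\sigma_\eta^2}\|y-m_N^{\mathcal G}(u)\|^2\Big)\Big),$$ $$\frac{d\mu^{y,N,\Phi}_{\mathrm{mean}}}{d\mu_0}(u)=\frac1{Z^{\mathrm{mean}}_{N,\Phi}}\exp(-m_N^{\Phi}(u)),\quad Z^{\mathrm{mean}}_{N,\Phi}=\mathbb E_{\mu_0}\big(\exp(-m_N^{\Phi}(u))\big).$$ The Hellinger distance between probability measures $\mu,\mu'$ absolutely continuous with respect to $\mu_0$ is $$d_{\mathrm{Hell}}(\mu,\mu')=\left(\frac12\int_X\left(\sqrt{\tfrac{d\mu}{d\mu_0}}-\sqrt{\tfrac{d\mu'}{d\mu_0}}\right)^2d\mu_0\right)^{1/2}.$$ *)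

(* Defs.v *)
From HB Require Import structures.
From mathcomp Require Import all_boot all_order all_algebra.
From mathcomp Require Import all_classical all_reals all_analysis.

Set Implicit Arguments.
Unset Strict Implicit.
Unset Printing Implicit Defensive.

Import Order.TTheory GRing.Theory Num.Theory.
Import numFieldNormedType.Exports.

Local Open Scope classical_set_scope.
Local Open Scope charge_scope.
Local Open Scope ring_scope.

(* R^n is modelled by n.-tuple R: it carries the product sigma-algebra (that is,
   the Borel one), whereas 'rV[R]_n has no measurable structure and its norm is
   the sup norm. *)
Definition vsub (R : realType) (n : nat) (a b : n.-tuple R) : n.-tuple R :=
  [tuple tnth a i - tnth b i | i < n].

Definition enorm (R : realType) (n : nat) (a : n.-tuple R) : R :=
  Num.sqrt (\sum_(i < n) tnth a i ^+ 2).

Definition misfit (R : realType) (T : Type) (J : nat) (y : J.-tuple R)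
    (sigma2 : R) (G : T -> J.-tuple R) (u : T) : R :=
  (2 * sigma2)^-1 * enorm (vsub y (G u)) ^+ 2.

Section measures.
Context (d : measure_display) (T : measurableType d) (R : realType).
Variables (mu0 : probability T R) (X : set T).

Definition normalizing_constant (phi : T -> R) : R :=
  (\int[mu0]_(u in X) expR (- phi u))%R.

(* The complement of X is a mu0-null set when mu0 X = 1, so the derivative only
   has to be prescribed on X. *)
Definition is_posterior (phi : T -> R) (mu : probability T R) : Prop :=
  mu `<< mu0 /\
  ae_eq mu0 X ('d (charge_of_finite_measure mu) '/d mu0)
    (fun u => ((normalizing_constant phi)^-1 * expR (- phi u))%:E).

(* Radon-Nikodym derivatives are extended-real valued in the library, but finite
   everywhere as soon as mu is dominated by mu0, which makes [fine] harmless. *)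
Definition density (mu : probability T R) (u : T) : R :=
  fine (('d (charge_of_finite_measure mu) '/d mu0) u).

Definition hellinger (mu mu' : probability T R) : \bar R :=
  ((2^-1)%:E * \int[mu0]_(u in X)
     ((Num.sqrt (density mu u) - Num.sqrt (density mu' u)) ^+ 2)%:E)%E `^ 2^-1.

Definition L2norm (f : T -> R) : \bar R :=
  Lnorm mu0 2%:E ((EFin \o f) \_ X).

End measures.

Definition sup_on (R : realType) (T : Type) (X : set T) (f : T -> R) : \bar R :=
  ereal_sup [set (f u)%:E | u in X].

Definition is_design (T : Type) (X : set T) (N : nat) (U : set T) : Prop :=
  U `<=` X /\ (U #= `I_N)%card.

(* Main.v *)
Require Import Defs.
From HB Require Import structures.
From mathcomp Require Import all_boot all_order all_algebra.
From mathcomp Require Import all_classical all_reals all_analysis.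
From mathcomp Require Import measurable_realfun ring lra.

Set Implicit Arguments.
Unset Strict Implicit.
Unset Printing Implicit Defensive.

Import Order.TTheory GRing.Theory Num.Theory.
Import numFieldNormedType.Exports.

Local Open Scope classical_set_scope.
Local Open Scope ring_scope.

(** The Hellinger distance is an L^2 distance between normalised vectors: up to
    the factor sqrt(1/2), it is the distance between exp(-phi1/2)/sqrt(Z1) and
    exp(-phi2/2)/sqrt(Z2), where exp(-phi/2) has L^2 norm sqrt(Z). Normalising
    two vectors a and b multiplies their distance by at most 1/sqrt(|a||b|)
    ([normalized_L2_dist]), so the normalising constants enter only through a
    lower bound.

    If both potentials are bounded by B on X, then Z1 and Z2 are at least
    exp(-B) because the prior has mass 1 ([normalizing_constant_ge]), and
    exp(-phi/2) is Lipschitz in phi with a constant depending on B alone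
    ([root_likelihood_lipschitz]). Together they give, for any g with
    |phi1 - phi2| <= c |g| on X, the bound d_Hell <= exp(B) c |g|_{L^2}
    ([hellinger_posterior_le]).

    The two claims are instances of this bound. Convergent error sequences are
    bounded, which bounds the approximate potentials uniformly in N and in the
    design, since the bound on G bounds the misfit ([enorm_vsub_sqr_le]). For an
    emulator of the misfit, g is the emulation error and c = 1. For an emulator
    of G, g is the norm of the error of G, and the factorisation of a difference
    of squares shows that the misfit is Lipschitz on bounded sets of
    observations ([enorm_sqr_dist_le]), which gives c. *)

Lemma expR_lipschitz (R : realType) (B x y : R) :
  x <= B -> y <= B -> `|expR x - expR y| <= expR B * `|x - y|.
Proof.
wlog xy : x y / x <= y => [wlg xB yB|_ yB].
  by case/orP: (le_total x y) => ?; [|rewrite distrC (distrC x)]; exact: wlg.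
rewrite distrC (distrC x) !ger0_norm ?subr_ge0 ?ler_expR//.
apply: (@le_trans _ _ (expR y * (y - x))); last first.
  by rewrite ler_wpM2r ?subr_ge0 ?ler_expR.
have -> : expR x = expR y * expR (x - y) by rewrite -expRD subrKC.
have := expR_ge1Dx (x - y); have := expR_gt0 y; nra.
Qed.

(** * Integrals on a probability space *)

Section probability_space.
Context (d : measure_display) (T : measurableType d) (R : realType).
Variables (mu0 : probability T R) (X : set T).
Hypothesis mX : measurable X.

Lemma bounded_integrable (f : T -> R) (M : R) : measurable_fun X f ->
  (forall u, X u -> `|f u| <= M) -> mu0.-integrable X (EFin \o f).
Proof.
move=> mf fM; apply: measurable_bounded_integrable => //.
  exact: le_lt_trans (probability_le1 mu0 mX) (ltry _).
exists M; split; first exact: num_real.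
by move=> x Mx u Xu; exact: le_trans (fM u Xu) (ltW Mx).
Qed.

Lemma measurable_sqrt (f : T -> R) :
  measurable_fun X f -> measurable_fun X (fun u => Num.sqrt (f u)).
Proof.
apply: measurableT_comp; apply: continuous_measurable_fun.
exact: sqrt_continuous.
Qed.

(** For vectors of L^2 norms s and t, expanding the squares gives the identity
    |a/s - b/t|^2 = (|a - b|^2 - (s - t)^2) / (s t),
    whose last square can be dropped. *)
Lemma normalized_L2_dist (a b : T -> R) (s t : R) :
  0 < s -> 0 < t ->
  mu0.-integrable X (EFin \o (fun u => a u ^+ 2)) ->
  mu0.-integrable X (EFin \o (fun u => b u ^+ 2)) ->
  mu0.-integrable X (EFin \o (fun u => (a u - b u) ^+ 2)) ->
  (\int[mu0]_(u in X) (a u ^+ 2))%R = s ^+ 2 ->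
  (\int[mu0]_(u in X) (b u ^+ 2))%R = t ^+ 2 ->
  (\int[mu0]_(u in X) ((s^-1 * a u - t^-1 * b u) ^+ 2)%:E
     <= ((s * t)^-1)%:E * \int[mu0]_(u in X) ((a u - b u) ^+ 2)%:E)%E.
Proof.
move=> s0 t0 ia ib iab as2 bt2.
have iZ k (f : T -> R) : mu0.-integrable X (EFin \o f) ->
    mu0.-integrable X (EFin \o (fun u => k * f u)).
  by move=> fi; exact: (integrableZl mX k fi).
have iD (f g : T -> R) : mu0.-integrable X (EFin \o f) ->
    mu0.-integrable X (EFin \o g) ->
    mu0.-integrable X (EFin \o (fun u => f u + g u)).
  by move=> fi gi; exact: (integrableD mX fi gi).
(* The coefficients are chosen so that the cross term a b occurs only in
   (a - b)^2: all the integrals are then known. *)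
have expand u : (s^-1 * a u - t^-1 * b u) ^+ 2 =
    (s * t)^-1 * (a u - b u) ^+ 2 +
    ((s^-1 ^+ 2 - (s * t)^-1) * a u ^+ 2 + (t^-1 ^+ 2 - (s * t)^-1) * b u ^+ 2).
  by field; rewrite (gt_eqF s0) (gt_eqF t0).
have intE : (\int[mu0]_(u in X) ((s^-1 * a u - t^-1 * b u) ^+ 2) =
    (s * t)^-1 * \int[mu0]_(u in X) ((a u - b u) ^+ 2)
    - (s * t)^-1 * (s - t) ^+ 2)%R.
  under eq_Rintegral do rewrite expand.
  rewrite (RintegralD mX (iZ _ _ iab) (iD _ _ (iZ _ _ ia) (iZ _ _ ib))).
  rewrite (RintegralD mX (iZ _ _ ia) (iZ _ _ ib)) !RintegralZl// as2 bt2.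
  by field; rewrite (gt_eqF s0) (gt_eqF t0).
have ih : mu0.-integrable X
    (EFin \o (fun u => (s^-1 * a u - t^-1 * b u) ^+ 2)).
  rewrite (funext expand).
  exact: (iD _ _ (iZ _ _ iab) (iD _ _ (iZ _ _ ia) (iZ _ _ ib))).
rewrite -[leLHS](fineK (integrable_fin_num mX ih)).
rewrite -[X in (_ * X)%E](fineK (integrable_fin_num mX iab)) -EFinM lee_fin.
rewrite -/(Rintegral _ _ _) -/(Rintegral _ _ _) intE gerBl.
by rewrite mulr_ge0 ?sqr_ge0// invr_ge0 mulr_ge0 ?ltW.
Qed.

(** * Stability of posteriors with bounded potentials *)

Lemma measurable_density (mu : probability T R) :
  mu `<< mu0 -> measurable_fun X (density mu0 mu).
Proof.
move=> mumu0.
have mfine : measurable_fun [set: \bar R] (@fine R) by exact: fine_measurable.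
have mRN := measurable_int _ (Radon_Nikodym_integrable
  (nu := charge_of_finite_measure mu) mumu0).
have := measurableT_comp mfine mRN.
exact: (@measurable_funS _ _ _ _ setT).
Qed.

(** The unnormalised square root of a posterior density; in L^2(mu0) its norm is
    the square root of the normalising constant. *)
Definition root_likelihood (phi : T -> R) (u : T) : R := expR (- (phi u / 2)).

Lemma root_likelihood_sqr (phi : T -> R) (u : T) :
  root_likelihood phi u ^+ 2 = expR (- phi u).
Proof. by rewrite -expRM_natl; congr expR; field. Qed.

Lemma measurable_root_likelihood (phi : T -> R) :
  measurable_fun X phi -> measurable_fun X (root_likelihood phi).
Proof.
move=> mphi; apply: measurableT_comp => //; apply: measurableT_comp => //.
exact: measurable_funM.
Qed.

Lemma root_likelihood_le (phi : T -> R) (B : R) (u : T) :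
  `|phi u| <= B -> `|root_likelihood phi u| <= expR (B / 2).
Proof.
move=> /ler_normlP[? ?].
by rewrite ger0_norm ?expR_ge0// ler_expR; lra.
Qed.

(** Both exponents are at most B/2, where exp has slope at most exp(B/2). The
    further factor 1/2 coming from the halved potentials is given up. *)
Lemma root_likelihood_lipschitz (phi1 phi2 : T -> R) (B : R) (u : T) :
  `|phi1 u| <= B -> `|phi2 u| <= B ->
  `|root_likelihood phi1 u - root_likelihood phi2 u|
     <= expR (B / 2) * `|phi1 u - phi2 u|.
Proof.
move=> /ler_normlP[? ?] /ler_normlP[? ?].
have h1 : - (phi1 u / 2) <= B / 2 by lra.
have h2 : - (phi2 u / 2) <= B / 2 by lra.
apply: le_trans (expR_lipschitz h1 h2) _.
rewrite ler_wpM2l ?expR_ge0//.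
rewrite -opprD normrN -mulrBl normrM [`|2^-1|]ger0_norm ?invr_ge0//.
have := normr_ge0 (phi1 u - phi2 u); lra.
Qed.

Lemma integrable_root_likelihood_sqr (phi : T -> R) (B : R) :
  measurable_fun X phi -> (forall u, X u -> `|phi u| <= B) ->
  mu0.-integrable X (EFin \o (fun u => root_likelihood phi u ^+ 2)).
Proof.
move=> mphi phiB; apply: (@bounded_integrable _ (expR (B / 2) ^+ 2)).
  exact/measurable_funX/measurable_root_likelihood.
move=> u Xu; rewrite normrX lerXn2r ?nnegrE ?expR_ge0//.
exact: root_likelihood_le (phiB u Xu).
Qed.

Lemma integrable_root_likelihood_dist (phi1 phi2 : T -> R) (B : R) :
  measurable_fun X phi1 -> measurable_fun X phi2 ->
  (forall u, X u -> `|phi1 u| <= B) -> (forall u, X u -> `|phi2 u| <= B) ->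
  mu0.-integrable X
    (EFin \o (fun u => (root_likelihood phi1 u - root_likelihood phi2 u) ^+ 2)).
Proof.
move=> mp1 mp2 p1B p2B.
apply: (@bounded_integrable _ ((2 * expR (B / 2)) ^+ 2)) => //.
  by apply: measurable_funX; apply: measurable_funB;
    exact: measurable_root_likelihood.
move=> u Xu; rewrite normrX lerXn2r ?nnegrE ?mulr_ge0 ?expR_ge0//.
rewrite (le_trans (ler_normB _ _))//.
have := root_likelihood_le (p1B u Xu).
have := root_likelihood_le (p2B u Xu); lra.
Qed.

Lemma sqrt_density_posterior (phi : T -> R) (mu : probability T R) :
  0 < normalizing_constant mu0 X phi -> is_posterior mu0 X phi mu ->
  ae_eq mu0 X (fun u => Num.sqrt (density mu0 mu u))
    (fun u => (Num.sqrt (normalizing_constant mu0 X phi))^-1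
              * root_likelihood phi u).
Proof.
move=> Z0 [_]; apply: filterS => u /[apply] dE.
rewrite /density dE /= sqrtrM ?invr_ge0 ?ltW// sqrtrV ?ltW//.
by rewrite -root_likelihood_sqr sqrtr_sqr gtr0_norm// expR_gt0.
Qed.

Hypothesis mu0X : mu0 X = 1%E.

(** The integrand is at least exp(-B), and X has full prior mass. *)
Lemma normalizing_constant_ge (phi : T -> R) (B : R) :
  measurable_fun X phi -> (forall u, X u -> `|phi u| <= B) ->
  expR (- B) <= normalizing_constant mu0 X phi.
Proof.
move=> mphi phiB.
rewrite -[leLHS](_ : (\int[mu0]_(u in X) expR (- B))%R = _); last first.
  rewrite Rintegral_cst// -[RHS]mulr1; congr (_ * _).
  exact: (congr1 fine mu0X).
apply: le_Rintegral => //.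
- by apply: (@bounded_integrable _ `|expR (- B)|) => //; exact: measurable_cst.
- apply: (@bounded_integrable _ (expR B)).
    by apply: measurableT_comp => //; exact: measurableT_comp.
  move=> u Xu; rewrite gtr0_norm ?expR_gt0// ler_expR lerNl.
  by have := phiB u Xu; rewrite ler_norml => /andP[].
- move=> u Xu; rewrite ler_expR lerN2.
  by have := phiB u Xu; rewrite ler_norml => /andP[].
Qed.

Lemma sqrt_product_inv_le (B Z1 Z2 : R) :
  expR (- B) <= Z1 -> expR (- B) <= Z2 ->
  (Num.sqrt Z1 * Num.sqrt Z2)^-1 <= expR B.
Proof.
move=> BZ1 BZ2; have Z1_ge0 := le_trans (expR_ge0 _) BZ1.
rewrite -sqrtrM// -[leRHS]invrK -expRN lef_pV2 ?posrE ?expR_gt0//; last first.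
  by rewrite sqrtr_gt0 mulr_gt0// (lt_le_trans (expR_gt0 (- B))).
rewrite -[leLHS]ger0_norm ?expR_ge0// -sqrtr_sqr ler_wsqrtr//.
by rewrite expr2 ler_pM ?expR_ge0.
Qed.

Lemma integral_sqrt_density_dist_le (phi1 phi2 : T -> R) (B : R)
    (mu1 mu2 : probability T R) :
  measurable_fun X phi1 -> measurable_fun X phi2 ->
  (forall u, X u -> `|phi1 u| <= B) -> (forall u, X u -> `|phi2 u| <= B) ->
  is_posterior mu0 X phi1 mu1 -> is_posterior mu0 X phi2 mu2 ->
  (\int[mu0]_(u in X)
     ((Num.sqrt (density mu0 mu1 u) - Num.sqrt (density mu0 mu2 u)) ^+ 2)%:E
   <= (expR B)%:E * \int[mu0]_(u in X)
     ((root_likelihood phi1 u - root_likelihood phi2 u) ^+ 2)%:E)%E.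
Proof.
move=> mp1 mp2 p1B p2B post1 post2.
have Z1B := normalizing_constant_ge mp1 p1B.
have Z2B := normalizing_constant_ge mp2 p2B.
have Z1_gt0 := lt_le_trans (expR_gt0 _) Z1B.
have Z2_gt0 := lt_le_trans (expR_gt0 _) Z2B.
have sd1 := sqrt_density_posterior Z1_gt0 post1.
have sd2 := sqrt_density_posterior Z2_gt0 post2.
have ZE phi : (\int[mu0]_(u in X) (root_likelihood phi u ^+ 2))%R =
    normalizing_constant mu0 X phi.
  by apply: eq_Rintegral => u _; rewrite root_likelihood_sqr.
have Z1E := ZE phi1; have Z2E := ZE phi2; move: {ZE} Z1E Z2E.
move: (normalizing_constant mu0 X phi1) Z1B Z1_gt0 sd1 => Z1 Z1B Z1_gt0 sd1.
move: (normalizing_constant mu0 X phi2) Z2B Z2_gt0 sd2 => Z2 Z2B Z2_gt0 sd2.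
move=> Z1E Z2E.
rewrite (_ : integral _ _ _ = (\int[mu0]_(u in X)
    (((Num.sqrt Z1)^-1 * root_likelihood phi1 u -
      (Num.sqrt Z2)^-1 * root_likelihood phi2 u) ^+ 2)%:E)%E); last first.
  apply: ge0_ae_eq_integral => //.
  - apply/measurable_EFinP; apply: measurable_funX; apply: measurable_funB;
      apply: measurable_sqrt; apply: measurable_density.
      by case: post1.
    by case: post2.
  - apply/measurable_EFinP; apply: measurable_funX; apply: measurable_funB;
      apply: measurable_funM => //; exact: measurable_root_likelihood.
  - by move=> u _; rewrite lee_fin sqr_ge0.
  - by move=> u _; rewrite lee_fin sqr_ge0.
  - by apply: filterS2 sd1 sd2 => u e1 e2 Xu; rewrite e1// e2.
rewrite -[Z1]sqr_sqrtr ?(ltW Z1_gt0)// in Z1E.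
rewrite -[Z2]sqr_sqrtr ?(ltW Z2_gt0)// in Z2E.
apply: le_trans (normalized_L2_dist _ _ (integrable_root_likelihood_sqr mp1 p1B)
  (integrable_root_likelihood_sqr mp2 p2B)
  (integrable_root_likelihood_dist mp1 mp2 p1B p2B) Z1E Z2E) _.
- by rewrite sqrtr_gt0.
- by rewrite sqrtr_gt0.
rewrite lee_wpmul2r ?lee_fin ?sqrt_product_inv_le//.
by apply: integral_ge0 => u _; rewrite lee_fin sqr_ge0.
Qed.

(** The function g decouples the two uses: it is the difference of the
    potentials itself, or a quantity that controls it. One factor exp(B/2)
    comes from the normalising constants, the other from the Lipschitz constant
    of the root likelihoods. *)
Lemma hellinger_posterior_le (phi1 phi2 g : T -> R) (B c : R)
    (mu1 mu2 : probability T R) :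
  measurable_fun X phi1 -> measurable_fun X phi2 -> measurable_fun X g ->
  (forall u, X u -> `|phi1 u| <= B) -> (forall u, X u -> `|phi2 u| <= B) ->
  0 <= c -> (forall u, X u -> `|phi1 u - phi2 u| <= c * `|g u|) ->
  is_posterior mu0 X phi1 mu1 -> is_posterior mu0 X phi2 mu2 ->
  (hellinger mu0 X mu1 mu2 <= (expR B * c)%:E * L2norm mu0 X g)%E.
Proof.
move=> mp1 mp2 mg p1B p2B c0 p12 post1 post2.
have sqr_ge0E (f : T -> R) : (0 <= \int[mu0]_(u in X) (f u ^+ 2)%:E)%E.
  by apply: integral_ge0 => u _; rewrite lee_fin sqr_ge0.
have msqr : measurable_fun X (fun u => `|g u| ^+ 2).
  by apply: measurable_funX; exact: measurableT_comp.
have key : (\int[mu0]_(u in X) (((Num.sqrt (density mu0 mu1 u) -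
     Num.sqrt (density mu0 mu2 u)) ^+ 2)%:E)
   <= ((expR B * c) ^+ 2)%:E * \int[mu0]_(u in X) ((`|g u| ^+ 2)%:E))%E.
  apply: le_trans
    (integral_sqrt_density_dist_le mp1 mp2 p1B p2B post1 post2) _.
  have -> : ((expR B * c) ^+ 2)%:E = ((expR B)%:E * (expR B * c ^+ 2)%:E)%E.
    by rewrite -EFinM; congr EFin; ring.
  rewrite -muleA lee_wpmul2l ?lee_fin ?expR_ge0//.
  rewrite -ge0_integralZl_EFin//.
  - apply: ge0_le_integral => //.
    + by move=> u _; rewrite lee_fin sqr_ge0.
    + exact: measurable_int (integrable_root_likelihood_dist mp1 mp2 p1B p2B).
    + by apply/measurable_EFinP; exact: measurable_funM.
    + move=> u Xu; rewrite lee_fin -[leLHS]ger0_norm ?sqr_ge0// normrX.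
      have -> : expR B * c ^+ 2 * `|g u| ^+ 2 =
          (expR (B / 2) * (c * `|g u|)) ^+ 2.
        by rewrite [in LHS](splitr B) expRD; ring.
      rewrite lerXn2r ?nnegrE ?mulr_ge0 ?expR_ge0//.
      apply: le_trans (root_likelihood_lipschitz (p1B u Xu) (p2B u Xu)) _.
      by rewrite ler_wpM2l ?expR_ge0// p12.
  - exact/measurable_EFinP.
  - by rewrite mulr_ge0 ?expR_ge0 ?sqr_ge0.
have eBc : 0 <= expR B * c by rewrite mulr_ge0 ?expR_ge0.
rewrite /hellinger /L2norm unlock.
rewrite (_ : (\int[mu0]_x _)%E = (\int[mu0]_(u in X) (`|g u| ^+ 2)%:E)%E);
  last first.
  rewrite [RHS]integral_mkcond; apply: eq_integral => u _.
  by rewrite /patch; case: ifPn => _ /=; rewrite powR_mulrn// normr0 expr0n.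
have -> : (expR B * c)%:E = (((expR B * c) ^+ 2)%:E `^ 2^-1)%E.
  by rewrite poweR_EFin powR12_sqrt ?sqr_ge0// sqrtr_sqr ger0_norm.
rewrite -poweRM ?lee_fin ?sqr_ge0//; apply: gt0_ler_poweR => //.
- by rewrite in_itv /= leey andbT mule_ge0 ?lee_fin ?invr_ge0.
- by rewrite in_itv /= leey andbT mule_ge0 ?lee_fin ?sqr_ge0.
apply: le_trans key; rewrite -[leRHS]mul1e lee_wpmul2r//.
by rewrite lee_fin invf_le1// ler1n.
Qed.

End probability_space.

(** * The least-squares misfit *)

Section euclidean_norm.
Context (R : realType) (J : nat).
Implicit Types a v w y : J.-tuple R.

Lemma enorm_ge0 a : 0 <= enorm a.
Proof. exact: sqrtr_ge0. Qed.

Lemma enorm_sqr a : enorm a ^+ 2 = \sum_(i < J) tnth a i ^+ 2.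
Proof. by rewrite sqr_sqrtr// sumr_ge0// => i _; rewrite sqr_ge0. Qed.

Lemma coord_le_enorm a i : `|tnth a i| <= enorm a.
Proof.
rewrite -sqrtr_sqr ler_wsqrtr// (bigD1 i)//= lerDl.
by rewrite sumr_ge0// => j _; rewrite sqr_ge0.
Qed.

(** Coordinatewise, (y - v)^2 - (y - w)^2 = (2 y - v - w) (w - v). The factor J
    comes from bounding each coordinate by the norm before summing. *)
Lemma enorm_sqr_dist_le y v w (C E : R) :
  enorm v <= C -> enorm (vsub v w) <= E ->
  `|enorm (vsub y v) ^+ 2 - enorm (vsub y w) ^+ 2|
    <= J%:R * (2 * enorm y + 2 * C + E) * enorm (vsub v w).
Proof.
move=> vC vwE; rewrite !enorm_sqr -sumrB.
apply: le_trans (ler_norm_sum _ _ _) _.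
apply: (@le_trans _ _
    (\sum_(i < J) (2 * enorm y + 2 * C + E) * enorm (vsub v w))).
  apply: ler_sum => i _.
  (* [w] is only known to be within E of [v], so that its coordinates are
     at most C + E in absolute value. *)
  have yi := coord_le_enorm y i; have vi := le_trans (coord_le_enorm v i) vC.
  have di := coord_le_enorm (vsub v w) i.
  have : `|tnth v i - tnth w i| <= E.
    by move: (le_trans di vwE); rewrite tnth_mktuple.
  move: di yi vi; rewrite !tnth_mktuple => di yi vi dE.
  rewrite subr_sqr normrM mulrC ler_pM//.
    by move: yi vi dE; rewrite !ler_norml => /andP[? ?] /andP[? ?] /andP[? ?];
      apply/andP; split; lra.
  rewrite distrC (_ : _ - _ = tnth v i - tnth w i)//; ring.
by rewrite sumr_const card_ord -mulrA [J%:R * _]mulr_natl.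
Qed.

Lemma enorm_vsub_sqr_le y v (C : R) :
  enorm v <= C -> enorm (vsub y v) ^+ 2 <= J%:R * (enorm y + C) ^+ 2.
Proof.
move=> vC; rewrite enorm_sqr mulr_natl.
rewrite -[in X in _ <= _ *+ X](card_ord J) -sumr_const.
apply: ler_sum => i _; rewrite tnth_mktuple.
rewrite -[leLHS]ger0_norm ?sqr_ge0// normrX.
have C0 := le_trans (enorm_ge0 v) vC.
rewrite lerXn2r ?nnegrE ?addr_ge0 ?enorm_ge0//.
rewrite (le_trans (ler_normB _ _))// lerD ?coord_le_enorm//.
exact: le_trans (coord_le_enorm v i) vC.
Qed.

Lemma measurable_enorm_vsub (d : measure_display) (T : measurableType d)
    (X : set T) (f g : T -> J.-tuple R) :
  measurable X -> measurable_fun X f -> measurable_fun X g ->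
  measurable_fun X (fun u => enorm (vsub (f u) (g u))).
Proof.
move=> mX mf mg; apply: measurable_sqrt => //; apply: measurable_sum => i.
under eq_fun do rewrite tnth_mktuple.
apply: measurable_funX; apply: measurable_funB.
  exact: (measurableT_comp (measurable_tnth i) mf).
exact: (measurableT_comp (measurable_tnth i) mg).
Qed.

Lemma measurable_misfit (d : measure_display) (T : measurableType d)
    (X : set T) (y : J.-tuple R) (sigma2 : R) (G : T -> J.-tuple R) :
  measurable X -> measurable_fun X G ->
  measurable_fun X (misfit y sigma2 G).
Proof.
move=> mX mG; apply: measurable_funM => //; apply: measurable_funX.
exact: (measurable_enorm_vsub mX (measurable_cst y) mG).
Qed.

End euclidean_norm.

Lemma le_sup_on (R : realType) (T : Type) (X : set T) (f : T -> R) (M : R)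
    (u : T) : (sup_on X f <= M%:E)%E -> X u -> f u <= M.
Proof.
move=> fM Xu; rewrite -lee_fin; apply: le_trans fM.
by apply: ereal_sup_ubound; exists u.
Qed.

Lemma cvg_bounded_above (R : realType) (e : nat -> R) (l : R) :
  e n @[n --> \oo] --> l -> exists2 M : R, 0 <= M & forall n, e n <= M.
Proof.
move=> el; have [M [_ eM]] : bounded_fun e.
  by apply: cvg_seq_bounded; apply/cvg_ex; exists l.
exists `|M + 1| => // n; have := eM (M + 1); rewrite ltrDl ltr01.
move=> /(_ isT n I) enM.
exact: le_trans (ler_norm _) (le_trans enM (ler_norm _)).
Qed.

Theorem theorem4p2 (R : realType) (K J : nat)
  (X : set (K.-tuple R)) (hX : measurable X)
  (G : K.-tuple R -> J.-tuple R) (hG : measurable_fun X G)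
  (y : J.-tuple R) (sigma2 : R) (hsigma2 : 0 < sigma2)
  (mu0 : probability (K.-tuple R) R) (hmu0 : mu0 X = 1%E)
  (muy : probability (K.-tuple R) R)
  (hmuy : is_posterior mu0 X (misfit y sigma2 G) muy)
  (mG : nat -> set (K.-tuple R) -> K.-tuple R -> J.-tuple R)
  (mPhi : nat -> set (K.-tuple R) -> K.-tuple R -> R)
  (hmG : forall N U, is_design X N U -> measurable_fun X (mG N U))
  (hmPhi : forall N U, is_design X N U -> measurable_fun X (mPhi N U))
  (CG : R) (hCG : (sup_on X (fun u => enorm (G u)) <= CG%:E)%E)
  (eG ePhi : nat -> R)
  (heG : eG n @[n --> \oo] --> (0 : R))
  (hePhi : ePhi n @[n --> \oo] --> (0 : R)) :
  exists C1 C2 : R,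
    forall U : nat -> set (K.-tuple R),
      (forall N, is_design X N (U N)) ->
      (forall N, sup_on X (fun u => enorm (vsub (G u) (mG N (U N) u)))
                 = (eG N)%:E) ->
      (forall N, sup_on X (fun u => `|misfit y sigma2 G u - mPhi N (U N) u|)
                 = (ePhi N)%:E) ->
      forall N : nat,
        (forall muG : probability (K.-tuple R) R,
           is_posterior mu0 X (misfit y sigma2 (mG N (U N))) muG ->
           (hellinger mu0 X muy muG
              <= C1%:E * L2norm mu0 X
                           (fun u => enorm (vsub (G u) (mG N (U N) u))))%E) /\
        (forall muPhi : probability (K.-tuple R) R,
           is_posterior mu0 X (mPhi N (U N)) muPhi ->
           (hellinger mu0 X muy muPhi
              <= C2%:E * L2norm mu0 X
                   (fun u => (misfit y sigma2 G u - mPhi N (U N) u)%R))%E).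
Proof.
have [E E0 eGE] := cvg_bounded_above heG.
have [E' E'0 ePhiE] := cvg_bounded_above hePhi.
have GC u : X u -> enorm (G u) <= CG by move=> Xu; exact: le_sup_on hCG Xu.
pose B1 := (2 * sigma2)^-1 * (J%:R * (enorm y + CG) ^+ 2).
pose c := (2 * sigma2)^-1 * (J%:R * (2 * enorm y + 2 * CG + E)).
have s0 : 0 <= (2 * sigma2)^-1 by rewrite invr_ge0 mulr_ge0// ltW.
(* [X] carries the prior, hence is inhabited, and [CG] bounds a norm. *)
have CG0 : 0 <= CG.
  have /set0P[u Xu] : X != set0.
    apply/eqP => X0; move: hmu0; rewrite X0 measure0 => /eqP.
    by rewrite eq_sym onee_eq0.
  exact: le_trans (enorm_ge0 _) (GC u Xu).
have c0 : 0 <= c.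
  by rewrite mulr_ge0// mulr_ge0// !addr_ge0 ?mulr_ge0 ?enorm_ge0.
have PhiB u : X u -> `|misfit y sigma2 G u| <= B1.
  move=> Xu; rewrite ger0_norm; last exact: mulr_ge0 s0 (sqr_ge0 _).
  by rewrite ler_wpM2l// enorm_vsub_sqr_le// GC.
have mPhiy : measurable_fun X (misfit y sigma2 G) by exact: measurable_misfit.
(* An emulator of the misfit is bounded by [B1] plus its error: c E when it is
   built from an emulator of [G], E' when the misfit is emulated directly. *)
exists (expR (B1 + c * E) * c); exists (expR (B1 + E') * 1).
move=> U hU supG supPhi N; split.
- move=> muG hmuG.
  have mmG := hmG N (U N) (hU N).
  have dE u : X u -> enorm (vsub (G u) (mG N (U N) u)) <= E.
    have supGE : (sup_on X (fun u => enorm (vsub (G u) (mG N (U N) u)))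
        <= E%:E)%E by rewrite supG lee_fin.
    by move=> Xu; exact: le_sup_on supGE Xu.
  have Lip u : X u -> `|misfit y sigma2 G u - misfit y sigma2 (mG N (U N)) u|
      <= c * `|enorm (vsub (G u) (mG N (U N) u))|.
    move=> Xu; rewrite -mulrBr normrM (ger0_norm s0) (ger0_norm (enorm_ge0 _)).
    by rewrite -mulrA ler_wpM2l// enorm_sqr_dist_le ?GC ?dE.
  apply: hellinger_posterior_le hmuy hmuG => //.
  + exact: measurable_misfit.
  + exact: measurable_enorm_vsub.
  + by move=> u Xu; rewrite (le_trans (PhiB u Xu))// lerDl mulr_ge0.
  + move=> u Xu; rewrite -[X in `|X|](subKr (misfit y sigma2 G u)).
    rewrite (le_trans (ler_normB _ _))// lerD ?PhiB//.
    rewrite (le_trans (Lip u Xu))// ler_wpM2l//.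
    by rewrite ger0_norm ?enorm_ge0// dE.
- move=> muPhi hmuPhi.
  have mmPhi := hmPhi N (U N) (hU N).
  have dE u : X u -> `|misfit y sigma2 G u - mPhi N (U N) u| <= E'.
    have supPhiE : (sup_on X
        (fun u => `|misfit y sigma2 G u - mPhi N (U N) u|%R) <= E'%:E)%E by rewrite supPhi lee_fin.
    by move=> Xu; exact: le_sup_on supPhiE Xu.
  apply: hellinger_posterior_le hmuy hmuPhi => //.
  + exact: measurable_funB.
  + by move=> u Xu; rewrite (le_trans (PhiB u Xu))// lerDl.
  + move=> u Xu; rewrite -[X in `|X|](subKr (misfit y sigma2 G u)).
    by rewrite (le_trans (ler_normB _ _))// lerD ?PhiB// dE.
  + by move=> u Xu; rewrite mul1r.
Qed.
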